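(* Let $p,q\in\mathbb{R}$. The double inequality $$(\cosh t)^{1-p}\left(\frac{\sinh t}{t}\right)^{p}<I_0(t)<q\,\frac{\sinh t}{t}+(1-q)\cosh t$$ holds for all $t>0$ if and only if $p\ge 3/4$ and $q\le 3/4$.
   Context: $I_0(t)=\sum_{n=0}^{\infty}\frac{t^{2n}}{2^{2n}(n!)^2}$ denotes the modified Bessel function of the first kind of order $0$. *)

(* Defs.v *)
From Stdlib Require Import Reals Factorial.
From Coquelicot Require Import Coquelicot.

Open Scope R_scope.

(** Modified Bessel function of the first kind of order 0. *)
Definition I0 (t : R) : R :=
  Series (fun n : nat => t ^ (2 * n) / (2 ^ (2 * n) * (INR (fact n)) ^ 2)).

(* Main.v *)
Require Import Defs.
From Stdlib Require Import Reals Factorial Lra Lia.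
From Coquelicot Require Import Coquelicot.

Open Scope R_scope.

(** The function [I0] solves [t f'' + f' = t f].  Write [L f] for
    [t f'' + f'].  The Wronskian [W = t (f' g - f g')] of two positive functions
    has derivative [(L f) g - f (L g)], so if [L f / f > L g / g] on the
    positive axis, [W] increases from its limit [0] at [0], hence [W > 0] and
    [f / g], of derivative [W / (t g ^ 2)], increases from its limit [1]: thus
    [f > g] ([bessel_comparison]).

    For the exponents [p = q = 3/4] both means of [cosh t] and [sinh t / t] can be
    compared with [I0] in this way.  For the arithmetic mean
    [H = 3/4 sinh t / t + 1/4 cosh t], [L H > t H] reduces to
    [t^2 sinh t - 3 t cosh t + 3 sinh t > 0]; for the geometric mean [G],
    [L G < t G] is a strict Riccati inequality for [(ln G)'], which reduces to
    [3 x^2 + 2 x sinh (2 x) + 2 x sinh x > 9/2 (cosh (2 x) - 1)] at [x = 2 t].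
    Both elementary inequalities come from repeated differentiation.  Other
    values [p >= 3/4], [q <= 3/4] follow by monotonicity in [p] and [q], because
    [sinh t / t < cosh t].

    Conversely, chain each hypothesis with the sharp bound on the other side, so
    that [I0] disappears: what remains compares a geometric and an arithmetic mean
    of [cosh t] and [sinh t / t], of weights [a] and [b] on [cosh t].  Since
    [cosh t = 1 + t^2/2 + ...] and [sinh t / t = 1 + t^2/6 + ...], the
    coefficients of [t^2] give [a <= b] ([weights_le_of_means_lt]), with
    [(a, b) = (1 - p, 1/4)] and [(1/4, 1 - q)]. *)

(** * Limits at zero from the right *)

Notation lim0 f l := (filterlim f (at_right 0) (locally l)).

Lemma lim0_ext (f g : R -> R) (l : R) :
  (forall t, 0 < t -> f t = g t) -> lim0 f l -> lim0 g l.
Proof.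
intros H; apply filterlim_ext_loc.
exists (mkposreal 1 Rlt_0_1); intros t _ Ht; now apply H.
Qed.

Lemma lim0_eq (a b : R) (f : R -> R) : a = b -> lim0 f a -> lim0 f b.
Proof. now intros ->. Qed.

Lemma lim0_le (f g : R -> R) (a b : R) :
  (forall t, 0 < t -> f t <= g t) -> lim0 f a -> lim0 g b -> a <= b.
Proof.
intros H Hf Hg.
apply (filterlim_le (F := at_right 0) f g a b); [|exact Hf|exact Hg].
exists (mkposreal 1 Rlt_0_1); intros t _ Ht; now apply H.
Qed.

Lemma lim0_squeeze (f g h : R -> R) (l : R) :
  (forall t, 0 < t -> f t <= g t <= h t) -> lim0 f l -> lim0 h l -> lim0 g l.
Proof.
intros H Hf Hh.
apply (filterlim_le_le (F := at_right 0) f g h l); [|exact Hf|exact Hh].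
exists (mkposreal 1 Rlt_0_1); intros t _ Ht; now apply H.
Qed.

Lemma lim0_plus (f g : R -> R) (a b : R) :
  lim0 f a -> lim0 g b -> lim0 (fun t => f t + g t) (a + b).
Proof.
intros Hf Hg.
exact (filterlim_comp_2 _ _ _ Hf Hg (filterlim_plus (a : R_NormedModule) b)).
Qed.

Lemma lim0_mult (f g : R -> R) (a b : R) :
  lim0 f a -> lim0 g b -> lim0 (fun t => f t * g t) (a * b).
Proof.
intros Hf Hg.
exact (filterlim_comp_2 _ _ _ Hf Hg (filterlim_mult (a : R_AbsRing) b)).
Qed.

Lemma lim0_const (a : R) : lim0 (fun _ => a) a.
Proof. apply filterlim_const. Qed.

Lemma lim0_comp (h f : R -> R) (a : R) :
  ex_derive h a -> lim0 f a -> lim0 (fun t => h (f t)) (h a).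
Proof.
intros Hh Hf; apply (filterlim_comp _ _ _ f h _ _ _ Hf).
exact (ex_derive_continuous h a Hh).
Qed.

Lemma lim0_at (f : R -> R) : ex_derive f 0 -> lim0 f (f 0).
Proof.
intros Hf; apply (filterlim_filter_le_1 (F := locally 0) f).
- intros P [e He]; exists e; intros t Ht _; now apply He.
- exact (ex_derive_continuous f 0 Hf).
Qed.

Lemma lim0_div (f g : R -> R) (a b : R) :
  b <> 0 -> lim0 f a -> lim0 g b -> lim0 (fun t => f t / g t) (a / b).
Proof.
intros Hb Hf Hg; apply lim0_mult; [exact Hf|].
apply (lim0_comp Rinv); [|exact Hg].
auto_derive; auto.
Qed.

(** * Monotonicity and comparison *)

Lemma increasing_gt_lim0 (f f' : R -> R) (l : R) :
  (forall t, 0 < t -> is_derive f t (f' t)) ->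
  (forall t, 0 < t -> 0 < f' t) ->
  lim0 f l -> forall t, 0 < t -> l < f t.
Proof.
intros Df Hf' Hl t Ht.
assert (mono : forall x y, 0 < x -> x < y -> f x < f y).
{ intros x y Hx Hxy.
  destruct (MVT_cor2 f f' x y Hxy) as [c [Hc Hcxy]].
  - intros c Hc; apply is_derive_Reals, Df; lra.
  - assert (0 < f' c * (y - x)) by (apply Rmult_lt_0_compat; [apply Hf'|]; lra).
    lra. }
apply Rle_lt_trans with (f (t / 2)); [|apply mono; lra].
apply (filterlim_le (F := at_right 0) f (fun _ => f (t / 2)) l (f (t / 2)));
  [|exact Hl|apply lim0_const].
assert (Ht2 : 0 < t / 2) by lra.
exists (mkposreal _ Ht2); intros s Hs Hs0.
unfold ball in Hs; simpl in Hs; unfold AbsRing_ball, abs, minus, plus, opp in Hs;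
  simpl in Hs.
apply Rabs_def2 in Hs.
apply Rlt_le, mono; lra.
Qed.

Lemma pos_of_deriv_pos (f f' : R -> R) :
  (forall t, is_derive f t (f' t)) -> f 0 = 0 ->
  (forall t, 0 < t -> 0 < f' t) -> forall t, 0 < t -> 0 < f t.
Proof.
intros Df f0 Hf'.
apply increasing_gt_lim0 with f'; [now intros t _|exact Hf'|].
rewrite <- f0 at 2; apply lim0_at; now exists (f' 0).
Qed.

(** [auto_derive] leaves derivatives in eta-expanded form, which [rewrite] does
    not match with [is_derive_unique]. *)
Lemma Derive_eta (f : R -> R) (x l : R) :
  is_derive f x l -> Derive (fun y : R => f y) x = l.
Proof. exact (is_derive_unique f x l). Qed.

(** A Sturm comparison for the operator [L f = t f'' + f'].  It is stated
    symmetrically in [f] and [g], rather than for sub- and supersolutions of a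
    fixed equation, so that [I0] can be placed on either side.  The limits of
    [t f'] and [t g'] make the boundary term of the Wronskian vanish at the
    singular point [0]. *)
Lemma bessel_comparison (f f' f'' g g' g'' : R -> R) :
  (forall t, 0 < t -> is_derive f t (f' t)) ->
  (forall t, 0 < t -> is_derive f' t (f'' t)) ->
  (forall t, 0 < t -> is_derive g t (g' t)) ->
  (forall t, 0 < t -> is_derive g' t (g'' t)) ->
  (forall t, 0 < t -> 0 < g t) ->
  lim0 f 1 -> lim0 (fun t => t * f' t) 0 ->
  lim0 g 1 -> lim0 (fun t => t * g' t) 0 ->
  (forall t, 0 < t -> (t * g'' t + g' t) * f t < (t * f'' t + f' t) * g t) ->
  forall t, 0 < t -> g t < f t.
Proof.
intros Df Df' Dg Dg' Hg Lf Lf' Lg Lg' Hop.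
(* The Wronskian increases from 0. *)
assert (HW : forall t, 0 < t -> 0 < t * (f' t * g t - f t * g' t)).
{ apply increasing_gt_lim0
    with (fun t => (t * f'' t + f' t) * g t - (t * g'' t + g' t) * f t).
  - intros t Ht; auto_derive.
    + repeat split; eexists; eauto.
    + rewrite (Derive_eta _ _ _ (Df t Ht)),
        (Derive_eta _ _ _ (Df' t Ht)),
        (Derive_eta _ _ _ (Dg t Ht)),
        (Derive_eta _ _ _ (Dg' t Ht)); ring.
  - intros t Ht; specialize (Hop t Ht); lra.
  - apply (lim0_ext (fun t => (t * f' t) * g t + (-1) * (f t * (t * g' t))));
      [intros; ring|].
    apply (lim0_eq (0 * 1 + (-1) * (1 * 0))); [ring|].
    apply lim0_plus; [now apply lim0_mult|].
    apply lim0_mult; [apply lim0_const|now apply lim0_mult]. }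
(* The numerator below is the Wronskian, so the quotient increases from 1. *)
intros t Ht.
assert (1 < f t / g t) as Hq.
{ revert t Ht; apply increasing_gt_lim0
    with (fun t => (t * (f' t * g t - f t * g' t)) / (t * g t ^ 2)).
  - intros t Ht; specialize (Hg t Ht); auto_derive.
    + repeat split; try (eexists; eauto); lra.
    + rewrite (Derive_eta _ _ _ (Df t Ht)),
        (Derive_eta _ _ _ (Dg t Ht)); field; lra.
  - intros t Ht; specialize (Hg t Ht); apply Rdiv_lt_0_compat; [now apply HW|].
    apply Rmult_lt_0_compat; [exact Ht|now apply pow_lt].
  - apply (lim0_eq (1 / 1)); [field|].
    now apply lim0_div. }
specialize (Hg t Ht).
apply (Rmult_lt_compat_r (g t)) in Hq; [|exact Hg].
replace (f t / g t * g t) with (f t) in Hq by (field; lra); lra.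
Qed.

(** * Hyperbolic functions *)

Ltac derive_hyp := unfold sinh, cosh; auto_derive; [easy | field].

Lemma is_derive_sinh (t : R) : is_derive sinh t (cosh t).
Proof. derive_hyp. Qed.

Lemma is_derive_cosh (t : R) : is_derive cosh t (sinh t).
Proof. derive_hyp. Qed.

Lemma cosh_sq (t : R) : cosh t ^ 2 = 1 + sinh t ^ 2.
Proof.
assert (E : exp t * exp (- t) = 1).
{ rewrite <- exp_plus, Rplus_opp_r; apply exp_0. }
unfold cosh, sinh; lra.
Qed.

Lemma exp_double (t : R) : exp (2 * t) = exp t ^ 2.
Proof. replace (2 * t) with (t + t) by ring; rewrite exp_plus; ring. Qed.

Lemma sinh_double (t : R) : sinh (2 * t) = 2 * sinh t * cosh t.
Proof.
unfold cosh, sinh.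
replace (- (2 * t)) with (2 * - t) by ring; rewrite !exp_double; field.
Qed.

Lemma cosh_double (t : R) : cosh (2 * t) = 1 + 2 * sinh t ^ 2.
Proof.
replace (1 + 2 * sinh t ^ 2) with (cosh t ^ 2 + sinh t ^ 2)
  by (rewrite cosh_sq; ring).
unfold cosh, sinh.
replace (- (2 * t)) with (2 * - t) by ring; rewrite !exp_double; field.
Qed.

Lemma cosh_pos (t : R) : 0 < cosh t.
Proof.
unfold cosh; assert (H := exp_pos t); assert (H' := exp_pos (- t)); lra.
Qed.

Lemma sinh_pos (t : R) : 0 < t -> 0 < sinh t.
Proof.
apply pos_of_deriv_pos with cosh.
- exact is_derive_sinh.
- exact sinh_0.
- intros; apply cosh_pos.
Qed.

Lemma cosh_gt_1 (t : R) : 0 < t -> 1 < cosh t.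
Proof.
intros Ht; apply Rlt_0_minus.
revert t Ht; apply (pos_of_deriv_pos (fun t => cosh t - 1) sinh).
- intros t; derive_hyp.
- rewrite cosh_0; ring.
- exact sinh_pos.
Qed.

Lemma sinh_gt_id (t : R) : 0 < t -> t < sinh t.
Proof.
intros Ht; apply Rlt_0_minus.
revert t Ht; apply (pos_of_deriv_pos (fun t => sinh t - t) (fun t => cosh t - 1)).
- intros t; derive_hyp.
- rewrite sinh_0; ring.
- intros t Ht; generalize (cosh_gt_1 t Ht); lra.
Qed.

Lemma sinh_lt_id_cosh (t : R) : 0 < t -> sinh t < t * cosh t.
Proof.
intros Ht; apply Rlt_0_minus.
revert t Ht; apply (pos_of_deriv_pos (fun t => t * cosh t - sinh t)
  (fun t => t * sinh t)).
- intros t; derive_hyp.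
- rewrite sinh_0; ring.
- intros t Ht; now apply Rmult_lt_0_compat; [|apply sinh_pos].
Qed.

(** The next four bounds squeeze [(cosh t - 1) / t^2] and
    [(sinh t / t - 1) / t^2] between multiples of [1] and of [cosh t], which
    gives the second-order coefficients at [0].  Each pair of bounds is the
    integral of the pair before it. *)
Lemma cosh_lower (t : R) : 0 < t -> 1 + t ^ 2 / 2 < cosh t.
Proof.
intros Ht; apply Rlt_0_minus.
revert t Ht; apply (pos_of_deriv_pos (fun t => cosh t - (1 + t ^ 2 / 2))
  (fun t => sinh t - t)).
- intros t; derive_hyp.
- rewrite cosh_0; field.
- intros t Ht; generalize (sinh_gt_id t Ht); lra.
Qed.

Lemma cosh_upper (t : R) : 0 < t -> cosh t < 1 + t ^ 2 / 2 * cosh t.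
Proof.
intros Ht; apply Rlt_0_minus.
revert t Ht; apply (pos_of_deriv_pos (fun t => 1 + t ^ 2 / 2 * cosh t - cosh t)
  (fun t => t * cosh t - sinh t + t ^ 2 / 2 * sinh t)).
- intros t; derive_hyp.
- rewrite cosh_0; field.
- intros t Ht; generalize (sinh_lt_id_cosh t Ht).
  assert (0 < t ^ 2 / 2 * sinh t); [|lra].
  apply Rmult_lt_0_compat; [nra|now apply sinh_pos].
Qed.

Lemma sinh_lower (t : R) : 0 < t -> t + t ^ 3 / 6 < sinh t.
Proof.
intros Ht; apply Rlt_0_minus.
revert t Ht; apply (pos_of_deriv_pos (fun t => sinh t - (t + t ^ 3 / 6))
  (fun t => cosh t - (1 + t ^ 2 / 2))).
- intros t; derive_hyp.
- rewrite sinh_0; field.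
- intros t Ht; generalize (cosh_lower t Ht); lra.
Qed.

Lemma sinh_upper (t : R) : 0 < t -> sinh t < t + t ^ 3 / 6 * cosh t.
Proof.
intros Ht; apply Rlt_0_minus.
revert t Ht; apply (pos_of_deriv_pos (fun t => t + t ^ 3 / 6 * cosh t - sinh t)
  (fun t => 1 + t ^ 2 / 2 * cosh t - cosh t + t ^ 3 / 6 * sinh t)).
- intros t; derive_hyp.
- rewrite sinh_0; field.
- intros t Ht; generalize (cosh_upper t Ht).
  assert (0 < t ^ 3 / 6 * sinh t); [|lra].
  apply Rmult_lt_0_compat; [|now apply sinh_pos].
  generalize (pow_lt t 3 Ht); lra.
Qed.

(** Up to the factor [1 / (4 t^2)], this expression is the defect [L H - t H]
    of the arithmetic mean [H]. *)
Lemma arithmetic_mean_defect_pos (t : R) :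
  0 < t -> 0 < t ^ 2 * sinh t - 3 * t * cosh t + 3 * sinh t.
Proof.
revert t; apply (pos_of_deriv_pos (fun t => t ^ 2 * sinh t - 3 * t * cosh t + 3 * sinh t)
  (fun t => t * (t * cosh t - sinh t))).
- intros t; derive_hyp.
- rewrite sinh_0; ring.
- intros t Ht; generalize (sinh_lt_id_cosh t Ht); intros.
  apply Rmult_lt_0_compat; lra.
Qed.

(** The expression vanishes to order 6 at [0].  Its derivatives up to the
    third vanish there too, and the fourth one is visibly positive. *)
Lemma double_angle_ineq (x : R) : 0 < x ->
  0 < 3 * x ^ 2 + 2 * x * sinh (2 * x) + 2 * x * sinh x - 9 / 2 * (cosh (2 * x) - 1).
Proof.
set (h4 := fun x => 32 * x * sinh (2 * x) - 8 * cosh (2 * x)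
                    + 2 * x * sinh x + 8 * cosh x).
set (h3 := fun x => 16 * x * cosh (2 * x) - 12 * sinh (2 * x)
                    + 2 * x * cosh x + 6 * sinh x).
set (h2 := fun x => 6 - 10 * cosh (2 * x) + 8 * x * sinh (2 * x)
                    + 4 * cosh x + 2 * x * sinh x).
set (h1 := fun x => 6 * x - 7 * sinh (2 * x) + 4 * x * cosh (2 * x)
                    + 2 * sinh x + 2 * x * cosh x).
set (h0 := fun x => 3 * x ^ 2 + 2 * x * sinh (2 * x) + 2 * x * sinh x
                    - 9 / 2 * (cosh (2 * x) - 1)).
assert (P4 : forall x, 0 < x -> 0 < h4 x).
{ clear x; intros x Hx; unfold h4.
  (* With [x cosh x > sinh x], the first term exceeds [64 sinh x ^ 2], and
     [cosh x > 1] bounds the two [cosh] terms below by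
     [-16 sinh x ^ 2]. *)
  rewrite sinh_double, cosh_double.
  assert (S := sinh_pos x Hx).
  assert (C := cosh_gt_1 x Hx).
  assert (SC := sinh_lt_id_cosh x Hx).
  nra. }
revert x; change (forall x, 0 < x -> 0 < h0 x).
apply pos_of_deriv_pos with h1;
  [intros t; unfold h0, h1; derive_hyp
  |unfold h0; rewrite ?Rmult_0_r, ?sinh_0, ?cosh_0; field|].
apply pos_of_deriv_pos with h2;
  [intros t; unfold h1, h2; derive_hyp
  |unfold h1; rewrite ?Rmult_0_r, ?sinh_0, ?cosh_0; field|].
apply pos_of_deriv_pos with h3;
  [intros t; unfold h2, h3; derive_hyp
  |unfold h2; rewrite ?Rmult_0_r, ?sinh_0, ?cosh_0; field|].
apply pos_of_deriv_pos with h4;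
  [intros t; unfold h3, h4; derive_hyp
  |unfold h3; rewrite ?Rmult_0_r, ?sinh_0, ?cosh_0; field|exact P4].
Qed.

(** The previous inequality at [x = 2 t], in terms of [sinh t] and [cosh t]: the
    form in which it appears for the geometric mean. *)
Lemma geometric_mean_defect_pos (t : R) : 0 < t ->
  9 * sinh t ^ 2 * cosh t ^ 2 <
  3 * t ^ 2 + 2 * t * sinh t * cosh t * (3 * cosh t ^ 2 + sinh t ^ 2).
Proof.
intros Ht.
assert (H2 : 0 < 2 * t) by lra.
generalize (double_angle_ineq (2 * t) H2).
rewrite !(cosh_double (2 * t)), !(sinh_double (2 * t)), cosh_double, sinh_double.
assert (E := cosh_sq t).
replace (cosh t ^ 2) with (1 + sinh t ^ 2) by lra.
replace ((2 * sinh t * cosh t) ^ 2) with (4 * sinh t ^ 2 * (1 + sinh t ^ 2))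
  by (rewrite <- E; ring).
lra.
Qed.

(** * Second-order behaviour at zero *)

Lemma lim0_sinhc : lim0 (fun t => sinh t / t) 1.
Proof.
apply (lim0_squeeze (fun _ => 1) _ cosh).
- intros t Ht; split.
  + apply Rmult_le_reg_r with t; [exact Ht|].
    replace (sinh t / t * t) with (sinh t) by (field; lra).
    generalize (sinh_gt_id t Ht); lra.
  + apply Rmult_le_reg_r with t; [exact Ht|].
    replace (sinh t / t * t) with (sinh t) by (field; lra).
    generalize (sinh_lt_id_cosh t Ht); lra.
- apply lim0_const.
- rewrite <- cosh_0; apply lim0_at; eexists; apply is_derive_cosh.
Qed.

Lemma lim0_cosh : lim0 cosh 1.
Proof. rewrite <- cosh_0; apply lim0_at; eexists; apply is_derive_cosh. Qed.

Lemma lim0_cosh_order2 : lim0 (fun t => (cosh t - 1) / t ^ 2) (1 / 2).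
Proof.
apply (lim0_squeeze (fun _ => 1 / 2) _ (fun t => 1 / 2 * cosh t)).
- intros t Ht.
  assert (Ht2 := pow_lt t 2 Ht).
  generalize (cosh_lower t Ht) (cosh_upper t Ht); intros L U.
  split; apply Rmult_le_reg_r with (t ^ 2); try exact Ht2;
    replace ((cosh t - 1) / t ^ 2 * t ^ 2) with (cosh t - 1) by (field; lra); lra.
- apply lim0_const.
- apply (lim0_eq (1 / 2 * 1)); [ring|].
  apply lim0_mult; [apply lim0_const|apply lim0_cosh].
Qed.

Lemma lim0_sinhc_order2 : lim0 (fun t => (sinh t / t - 1) / t ^ 2) (1 / 6).
Proof.
apply (lim0_squeeze (fun _ => 1 / 6) _ (fun t => 1 / 6 * cosh t)).
- intros t Ht.
  assert (Ht3 := pow_lt t 3 Ht).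
  generalize (sinh_lower t Ht) (sinh_upper t Ht); intros L U.
  split; apply Rmult_le_reg_r with (t ^ 3); try exact Ht3;
    replace ((sinh t / t - 1) / t ^ 2 * t ^ 3) with (sinh t - t) by (field; lra);
    lra.
- apply lim0_const.
- apply (lim0_eq (1 / 6 * 1)); [ring|].
  apply lim0_mult; [apply lim0_const|apply lim0_cosh].
Qed.

Lemma ln_le_sub1 (y : R) : 0 < y -> ln y <= y - 1.
Proof.
intros Hy; generalize (exp_ineq1_le (ln y)); rewrite exp_ln; lra.
Qed.

Lemma ln_ge_sub1_div (y : R) : 0 < y -> (y - 1) / y <= ln y.
Proof.
intros Hy.
assert (H := ln_le_sub1 (/ y) (Rinv_0_lt_compat y Hy)).
rewrite ln_Rinv in H by exact Hy.
replace ((y - 1) / y) with (1 - / y) by (field; lra); lra.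
Qed.

(** Squeezes [ln u] between [(u - 1) / u] and [u - 1]. *)
Lemma lim0_ln_order2 (u : R -> R) (c : R) :
  (forall t, 0 < t -> 0 < u t) -> lim0 u 1 ->
  lim0 (fun t => (u t - 1) / t ^ 2) c -> lim0 (fun t => ln (u t) / t ^ 2) c.
Proof.
intros Hu Lu Lc.
apply (lim0_squeeze (fun t => (u t - 1) / t ^ 2 / u t) _
  (fun t => (u t - 1) / t ^ 2)); [|apply (lim0_eq (c / 1)); [field|]|exact Lc].
- intros t Ht; specialize (Hu t Ht).
  assert (0 < / t ^ 2) by now apply Rinv_0_lt_compat, pow_lt.
  split.
  + replace ((u t - 1) / t ^ 2 / u t) with ((u t - 1) / u t * / t ^ 2)
      by (field; split; lra).
    apply Rmult_le_compat_r; [lra|now apply ln_ge_sub1_div].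
  + apply Rmult_le_compat_r; [lra|now apply ln_le_sub1].
- apply lim0_div; [lra|exact Lc|exact Lu].
Qed.

Lemma sinhc_gt_1 (t : R) : 0 < t -> 1 < sinh t / t.
Proof.
intros Ht; apply Rmult_lt_reg_r with t; [exact Ht|].
replace (sinh t / t * t) with (sinh t) by (field; lra).
generalize (sinh_gt_id t Ht); lra.
Qed.

Lemma sinhc_lt_cosh (t : R) : 0 < t -> sinh t / t < cosh t.
Proof.
intros Ht; apply Rmult_lt_reg_r with t; [exact Ht|].
replace (sinh t / t * t) with (sinh t) by (field; lra).
generalize (sinh_lt_id_cosh t Ht); lra.
Qed.

(** Dividing by [t^2] and letting [t] tend to [0], the means of [1/2] and [1/6] of
    weights [a] and [b] are compared.  The right-hand side is an arithmetic mean
    minus [1]: it bounds the logarithm of that mean and is linear in [cosh t] and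
    [sinh t / t]. *)
Lemma weights_le_of_means_lt (a b : R) :
  (forall t, 0 < t -> a * ln (cosh t) + (1 - a) * ln (sinh t / t) <
     b * (cosh t - 1) + (1 - b) * (sinh t / t - 1)) -> a <= b.
Proof.
intros H.
enough (a * (1 / 2) + (1 - a) * (1 / 6) <= b * (1 / 2) + (1 - b) * (1 / 6)) by lra.
apply (lim0_le
  (fun t => a * (ln (cosh t) / t ^ 2) + (1 - a) * (ln (sinh t / t) / t ^ 2))
  (fun t => b * ((cosh t - 1) / t ^ 2) + (1 - b) * ((sinh t / t - 1) / t ^ 2))).
- intros t Ht; specialize (H t Ht).
  assert (0 < / t ^ 2) by now apply Rinv_0_lt_compat, pow_lt.
  apply Rlt_le in H.
  apply (Rmult_le_compat_r (/ t ^ 2)) in H; [|lra].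
  unfold Rdiv in *; lra.
- apply lim0_plus; apply lim0_mult; try apply lim0_const; apply lim0_ln_order2.
  + intros; apply cosh_pos.
  + apply lim0_cosh.
  + apply lim0_cosh_order2.
  + intros t Ht; generalize (sinhc_gt_1 t Ht); lra.
  + apply lim0_sinhc.
  + apply lim0_sinhc_order2.
- apply lim0_plus; apply lim0_mult; try apply lim0_const.
  + apply lim0_cosh_order2.
  + apply lim0_sinhc_order2.
Qed.

(** * The Bessel function and its differential equation *)

(** Coefficients of [I0] as a power series in [t^2]: in the variable [t] the odd
    coefficients vanish, and the ratio test does not apply. *)
Definition bessel_coef (n : nat) : R := / (4 ^ n * INR (fact n) ^ 2).

Lemma bessel_coef_pos (n : nat) : 0 < bessel_coef n.
Proof.
apply Rinv_0_lt_compat, Rmult_lt_0_compat; apply pow_lt; [lra|].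
apply INR_fact_lt_0.
Qed.

Lemma bessel_coef_rec (n : nat) :
  4 * INR (S n) ^ 2 * bessel_coef (S n) = bessel_coef n.
Proof.
unfold bessel_coef.
rewrite fact_simpl, mult_INR.
assert (H1 := INR_fact_neq_0 n).
assert (H2 := not_0_INR (S n) ltac:(lia)).
assert (H3 : 4 ^ n <> 0) by (apply pow_nonzero; lra).
simpl (4 ^ S n); field; auto.
Qed.

Lemma I0_PSeries (t : R) : I0 t = PSeries bessel_coef (t ^ 2).
Proof.
apply Series_ext; intros n; unfold bessel_coef, Rdiv.
rewrite <- pow_mult, (pow_mult 2); replace (2 ^ 2) with 4 by ring; ring.
Qed.

Lemma bessel_radius : CV_radius bessel_coef = p_infty.
Proof.
apply CV_radius_infinite_DAlembert.
- intros n; generalize (bessel_coef_pos n); lra.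
- apply (is_lim_seq_le_le (fun _ => 0) _ (fun n => / INR (S n))).
  + intros n.
    assert (H := bessel_coef_pos n); assert (H' := bessel_coef_pos (S n)).
    assert (Hn : 1 <= INR (S n)) by (change 1 with (INR 1); apply le_INR; lia).
    rewrite Rabs_pos_eq by (apply Rlt_le, Rdiv_lt_0_compat; assumption).
    split; [apply Rlt_le, Rdiv_lt_0_compat; assumption|].
    rewrite <- (bessel_coef_rec n).
    apply Rmult_le_reg_r with (4 * INR (S n) ^ 2); [nra|].
    replace (bessel_coef (S n) / (4 * INR (S n) ^ 2 * bessel_coef (S n)) *
      (4 * INR (S n) ^ 2)) with 1 by (field; lra).
    replace (/ INR (S n) * (4 * INR (S n) ^ 2)) with (4 * INR (S n)) by (field; lra).
    lra.
  + apply is_lim_seq_const.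
  + replace (Finite 0) with (Rbar_inv p_infty) by reflexivity.
    apply is_lim_seq_inv; [|discriminate].
    apply -> is_lim_seq_incr_1; apply is_lim_seq_INR.
Qed.

Definition bessel_series := PSeries bessel_coef.
Definition d_bessel_series := PSeries (PS_derive bessel_coef).
Definition d2_bessel_series := PSeries (PS_derive (PS_derive bessel_coef)).

Lemma is_derive_bessel_series (y : R) : is_derive bessel_series y (d_bessel_series y).
Proof. apply is_derive_PSeries; now rewrite bessel_radius. Qed.

Lemma is_derive_d_bessel_series (y : R) :
  is_derive d_bessel_series y (d2_bessel_series y).
Proof. apply is_derive_PSeries; now rewrite CV_radius_derive, bessel_radius. Qed.

(** Comparison of coefficients: this is [bessel_coef_rec]. *)
Lemma bessel_series_ode (y : R) :
  4 * d_bessel_series y + 4 * y * d2_bessel_series y = bessel_series y.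
Proof.
unfold bessel_series, d_bessel_series, d2_bessel_series.
rewrite <- PSeries_scal, Rmult_assoc, <- PSeries_incr_1, <- PSeries_scal.
rewrite <- PSeries_plus.
- apply PSeries_ext; intros n.
  rewrite <- (bessel_coef_rec n).
  destruct n as [|n]; unfold PS_plus, PS_scal, PS_derive, PS_incr_1.
  + change (4 * (INR 1 * bessel_coef 1) + 4 * 0 =
            4 * INR 1 ^ 2 * bessel_coef 1); simpl INR; ring.
  + change (4 * (INR (S (S n)) * bessel_coef (S (S n))) +
            4 * (INR (S n) * (INR (S (S n)) * bessel_coef (S (S n)))) =
            4 * INR (S (S n)) ^ 2 * bessel_coef (S (S n))).
    rewrite (S_INR (S n)); ring.
- apply CV_radius_inside.
  rewrite CV_radius_scal, CV_radius_derive, bessel_radius by lra; exact I.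
- apply CV_radius_inside.
  rewrite CV_radius_scal, CV_radius_incr_1, !CV_radius_derive, bessel_radius by lra.
  exact I.
Qed.

Definition dI0 (t : R) : R := 2 * t * d_bessel_series (t ^ 2).
Definition d2I0 (t : R) : R :=
  2 * d_bessel_series (t ^ 2) + 4 * t ^ 2 * d2_bessel_series (t ^ 2).

Lemma is_derive_I0 (t : R) : is_derive I0 t (dI0 t).
Proof.
apply (is_derive_ext (fun t => bessel_series (t ^ 2)));
  [intros; now rewrite I0_PSeries|].
replace (dI0 t) with (scal (2 * t) (d_bessel_series (t ^ 2)))
  by (unfold dI0, scal; simpl; unfold mult; simpl; ring).
apply (is_derive_comp bessel_series); [apply is_derive_bessel_series|].
auto_derive; [easy|ring].
Qed.

Lemma is_derive_dI0 (t : R) : is_derive dI0 t (d2I0 t).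
Proof.
unfold dI0, d2I0; auto_derive.
- exists (d2_bessel_series (t * (t * 1))); apply is_derive_d_bessel_series.
- rewrite (Derive_eta d_bessel_series _ (d2_bessel_series (t * (t * 1)))
    (is_derive_d_bessel_series _)).
  replace (t ^ 2) with (t * (t * 1)) by ring; ring.
Qed.

Lemma I0_ode (t : R) : t * d2I0 t + dI0 t = t * I0 t.
Proof.
rewrite I0_PSeries; fold bessel_series; rewrite <- bessel_series_ode.
unfold d2I0, dI0; ring.
Qed.

Lemma I0_0 : I0 0 = 1.
Proof.
rewrite I0_PSeries; replace (0 ^ 2) with 0 by ring; rewrite PSeries_0.
unfold bessel_coef; simpl; field.
Qed.

Lemma lim0_I0 : lim0 I0 1.
Proof. rewrite <- I0_0; apply lim0_at; eexists; apply is_derive_I0. Qed.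

Lemma lim0_t_dI0 : lim0 (fun t => t * dI0 t) 0.
Proof.
apply (lim0_eq (0 * dI0 0)); [ring|].
apply (lim0_at (fun t => t * dI0 t)).
auto_derive; eexists; apply is_derive_dI0.
Qed.

Lemma I0_pos (t : R) : 0 < I0 t.
Proof.
rewrite I0_PSeries.
assert (Ex : ex_series (fun n => bessel_coef n * (t ^ 2) ^ n)).
{ apply ex_series_Rabs, CV_disk_inside; now rewrite bessel_radius. }
unfold PSeries; rewrite Series_incr_1 by exact Ex.
assert (0 <= Series (fun n => bessel_coef (S n) * (t ^ 2) ^ S n)).
{ rewrite <- (Rmult_0_l (Series (fun _ => 0))), <- Series_scal_l.
  apply Series_le.
  - intros n; split; [lra|]; rewrite Rmult_0_l.
    apply Rmult_le_pos; [apply Rlt_le, bessel_coef_pos|].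
    apply pow_le, pow2_ge_0.
  - now apply (ex_series_incr_1 (fun n => bessel_coef n * (t ^ 2) ^ n)). }
rewrite pow_O, Rmult_1_r; generalize (bessel_coef_pos 0); lra.
Qed.

(** * Comparison with the arithmetic mean *)

Lemma I0_lt_arithmetic_mean (t : R) :
  0 < t -> I0 t < 3 / 4 * (sinh t / t) + 1 / 4 * cosh t.
Proof.
revert t.
apply (bessel_comparison (fun t => 3 / 4 * (sinh t / t) + 1 / 4 * cosh t)
  (fun t => 3 / 4 * (cosh t / t - sinh t / t ^ 2) + 1 / 4 * sinh t)
  (fun t => 3 / 4 * (sinh t / t - 2 * cosh t / t ^ 2 + 2 * sinh t / t ^ 3)
            + 1 / 4 * cosh t)
  I0 dI0 d2I0).
- intros t Ht; unfold sinh, cosh; auto_derive; [lra|field; lra].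
- intros t Ht; unfold sinh, cosh; auto_derive; [split; nra|field; lra].
- intros; apply is_derive_I0.
- intros; apply is_derive_dI0.
- intros; apply I0_pos.
- apply (lim0_eq (3 / 4 * 1 + 1 / 4 * 1)); [field|].
  apply lim0_plus; apply lim0_mult;
    [apply lim0_const|apply lim0_sinhc|apply lim0_const|apply lim0_cosh].
- apply (lim0_ext (fun t => 3 / 4 * (cosh t + (-1) * (sinh t / t))
    + 1 / 4 * (t * sinh t))).
  { intros t Ht; field; lra. }
  apply (lim0_eq (3 / 4 * (1 + (-1) * 1) + 1 / 4 * (0 * sinh 0)));
    [rewrite sinh_0; field|].
  apply lim0_plus; (apply lim0_mult; [apply lim0_const|]).
  + apply lim0_plus; [apply lim0_cosh|].
    apply lim0_mult; [apply lim0_const|apply lim0_sinhc].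
  + apply (lim0_at (fun t => t * sinh t)); unfold sinh; auto_derive; easy.
- apply lim0_I0.
- apply lim0_t_dI0.
- intros t Ht; rewrite I0_ode.
  assert (Hm := arithmetic_mean_defect_pos t Ht).
  assert (E : (t * (3 / 4 * (sinh t / t - 2 * cosh t / t ^ 2 + 2 * sinh t / t ^ 3)
                    + 1 / 4 * cosh t)
               + (3 / 4 * (cosh t / t - sinh t / t ^ 2) + 1 / 4 * sinh t))
              = t * (3 / 4 * (sinh t / t) + 1 / 4 * cosh t)
                + (t ^ 2 * sinh t - 3 * t * cosh t + 3 * sinh t) / (4 * t ^ 2))
    by (field; lra).
  rewrite E.
  assert (0 < (t ^ 2 * sinh t - 3 * t * cosh t + 3 * sinh t) / (4 * t ^ 2) * I0 t);
    [|lra].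
  apply Rmult_lt_0_compat; [apply Rdiv_lt_0_compat; nra|apply I0_pos].
Qed.

(** * Comparison with the geometric mean *)

(** [exp (ln_geom_mean t)] is the geometric mean.  Its logarithm turns the second-order
    inequality into a Riccati inequality for [d_ln_geom_mean]. *)
Definition ln_geom_mean (t : R) : R := 1 / 4 * ln (cosh t) + 3 / 4 * ln (sinh t / t).
Definition d_ln_geom_mean (t : R) : R :=
  1 / 4 * (sinh t / cosh t) + 3 / 4 * (cosh t / sinh t - / t).
Definition d2_ln_geom_mean (t : R) : R :=
  1 / 4 * (1 - sinh t ^ 2 / cosh t ^ 2)
  + 3 / 4 * (1 - cosh t ^ 2 / sinh t ^ 2 + / t ^ 2).

Lemma is_derive_ln_geom_mean (t : R) :
  0 < t -> is_derive ln_geom_mean t (d_ln_geom_mean t).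
Proof.
intros Ht; unfold ln_geom_mean, d_ln_geom_mean.
assert (C := cosh_pos t); assert (S := sinh_pos t Ht).
assert (SC := sinhc_gt_1 t Ht).
unfold sinh, cosh in *; auto_derive.
- repeat split; lra.
- field; repeat split; lra.
Qed.

Lemma is_derive_d_ln_geom_mean (t : R) :
  0 < t -> is_derive d_ln_geom_mean t (d2_ln_geom_mean t).
Proof.
intros Ht; unfold d_ln_geom_mean, d2_ln_geom_mean.
assert (C := cosh_pos t); assert (S := sinh_pos t Ht).
unfold sinh, cosh in *; auto_derive.
- repeat split; lra.
- field; repeat split; lra.
Qed.

Lemma lim0_ln_geom_mean : lim0 ln_geom_mean 0.
Proof.
unfold ln_geom_mean.
apply (lim0_eq (1 / 4 * ln 1 + 3 / 4 * ln 1)); [rewrite ln_1; ring|].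
assert (D : ex_derive ln 1) by (eexists; apply is_derive_ln; lra).
apply lim0_plus; (apply lim0_mult; [apply lim0_const|]).
- apply (lim0_comp ln cosh); [exact D|apply lim0_cosh].
- apply (lim0_comp ln (fun t => sinh t / t)); [exact D|apply lim0_sinhc].
Qed.

Lemma lim0_t_d_ln_geom_mean : lim0 (fun t => t * d_ln_geom_mean t) 0.
Proof.
apply (lim0_ext (fun t => 1 / 4 * (t * sinh t / cosh t)
  + 3 / 4 * (cosh t / (sinh t / t) + (-1)))).
{ intros t Ht; generalize (cosh_pos t) (sinh_pos t Ht); intros.
  unfold d_ln_geom_mean; field; lra. }
apply (lim0_eq (1 / 4 * (0 * sinh 0 / 1) + 3 / 4 * (1 / 1 + (-1)))); [field|].
apply lim0_plus; (apply lim0_mult; [apply lim0_const|]).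
- apply lim0_div; [lra| |apply lim0_cosh].
  apply (lim0_at (fun t => t * sinh t)); unfold sinh; auto_derive; easy.
- apply lim0_plus; [|apply lim0_const].
  apply lim0_div; [lra|apply lim0_cosh|apply lim0_sinhc].
Qed.

(** Equivalently [L G < t G] for [G = exp ln_geom_mean], after division by [G]. *)
Lemma ln_geom_mean_riccati (t : R) :
  0 < t -> t * (d2_ln_geom_mean t + d_ln_geom_mean t ^ 2) + d_ln_geom_mean t < t.
Proof.
intros Ht; apply Rlt_0_minus.
assert (C := cosh_pos t); assert (S := sinh_pos t Ht).
assert (H := geometric_mean_defect_pos t Ht).
replace (t - (t * (d2_ln_geom_mean t + d_ln_geom_mean t ^ 2) + d_ln_geom_mean t)) with
  ((3 * t ^ 2 + 2 * t * sinh t * cosh t * (3 * cosh t ^ 2 + sinh t ^ 2)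
    - 9 * sinh t ^ 2 * cosh t ^ 2)
   / (16 * t * sinh t ^ 2 * cosh t ^ 2)).
{ apply Rdiv_lt_0_compat; [lra|].
  assert (S2 := pow_lt _ 2 S); assert (C2 := pow_lt _ 2 C).
  apply Rmult_lt_0_compat; [apply Rmult_lt_0_compat|]; lra. }
unfold d2_ln_geom_mean, d_ln_geom_mean.
(* Inserting [1 = (cosh t ^ 2 - sinh t ^ 2) ^ 2] in front of [3 t^2] makes both
   sides equal as rational functions of [t], [sinh t], [cosh t]. *)
assert (E := cosh_sq t).
assert (E' : 1 = (cosh t ^ 2 - sinh t ^ 2) ^ 2) by (rewrite E; ring).
replace (3 * t ^ 2) with (3 * t ^ 2 * (cosh t ^ 2 - sinh t ^ 2) ^ 2)
  by (rewrite <- E'; ring).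
field; lra.
Qed.

Lemma geometric_mean_lt_I0 (t : R) : 0 < t -> exp (ln_geom_mean t) < I0 t.
Proof.
revert t; apply (bessel_comparison I0 dI0 d2I0 (fun t => exp (ln_geom_mean t))
  (fun t => d_ln_geom_mean t * exp (ln_geom_mean t))
  (fun t => (d2_ln_geom_mean t + d_ln_geom_mean t ^ 2) * exp (ln_geom_mean t))).
- intros; apply is_derive_I0.
- intros; apply is_derive_dI0.
- intros t Ht.
  apply (is_derive_comp exp ln_geom_mean);
    [apply is_derive_exp|now apply is_derive_ln_geom_mean].
- intros t Ht; assert (D := is_derive_ln_geom_mean t Ht).
  assert (D2 := is_derive_d_ln_geom_mean t Ht).
  auto_derive.
  + repeat split; eexists; eassumption.
  + rewrite (Derive_eta ln_geom_mean _ _ D), (Derive_eta d_ln_geom_mean _ _ D2); ring.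
- intros; apply exp_pos.
- apply lim0_I0.
- apply lim0_t_dI0.
- rewrite <- exp_0; apply (lim0_comp exp ln_geom_mean); [|apply lim0_ln_geom_mean].
  eexists; apply is_derive_exp.
- apply (lim0_ext (fun t => t * d_ln_geom_mean t * exp (ln_geom_mean t)));
    [intros; ring|].
  apply (lim0_eq (0 * exp 0)); [ring|].
  apply lim0_mult; [apply lim0_t_d_ln_geom_mean|].
  apply (lim0_comp exp ln_geom_mean); [|apply lim0_ln_geom_mean].
  eexists; apply is_derive_exp.
- intros t Ht; rewrite I0_ode.
  generalize (ln_geom_mean_riccati t Ht); intros H.
  assert (P := Rmult_lt_0_compat _ _ (exp_pos (ln_geom_mean t)) (I0_pos t)).
  apply (Rmult_lt_compat_r _ _ _ P) in H; lra.
Qed.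

(** * Optimality of the weights *)

Lemma weighted_geometric_mean_exp (a b p : R) :
  Rpower a (1 - p) * Rpower b p = exp ((1 - p) * ln a + p * ln b).
Proof. symmetry; apply exp_plus. Qed.

Theorem theorem4 (p q : R) :
  (forall t : R, 0 < t ->
     Rpower (cosh t) (1 - p) * Rpower (sinh t / t) p < I0 t /\
     I0 t < q * (sinh t / t) + (1 - q) * cosh t)
  <-> (p >= 3 / 4 /\ q <= 3 / 4).
Proof.
split.
- intros H; split.
  + enough (1 - p <= 1 / 4) by lra.
    apply weights_le_of_means_lt; intros t Ht.
    destruct (H t Ht) as [L _].
    assert (U := I0_lt_arithmetic_mean t Ht).
    rewrite weighted_geometric_mean_exp in L.
    set (w := (1 - p) * ln (cosh t) + p * ln (sinh t / t)) in L.
    replace ((1 - p) * ln (cosh t) + (1 - (1 - p)) * ln (sinh t / t)) with w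
      by (unfold w; ring).
    generalize (exp_ineq1_le w); lra.
  + enough (1 / 4 <= 1 - q) by lra.
    apply weights_le_of_means_lt; intros t Ht.
    destruct (H t Ht) as [_ U].
    assert (L := geometric_mean_lt_I0 t Ht).
    generalize (exp_ineq1_le (ln_geom_mean t)); unfold ln_geom_mean in *; lra.
- intros [Hp Hq] t Ht.
  assert (S1 := sinhc_gt_1 t Ht); assert (SC := sinhc_lt_cosh t Ht).
  split.
  + rewrite weighted_geometric_mean_exp.
    apply Rle_lt_trans with (exp (ln_geom_mean t)); [|now apply geometric_mean_lt_I0].
    assert (Hln : ln (sinh t / t) < ln (cosh t)) by (apply ln_increasing; lra).
    assert (W : (1 - p) * ln (cosh t) + p * ln (sinh t / t) <= ln_geom_mean t)
      by (unfold ln_geom_mean; nra).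
    destruct W as [W|W]; [left; now apply exp_increasing|rewrite W; apply Rle_refl].
  + assert (U := I0_lt_arithmetic_mean t Ht); nra.
Qed.
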